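(* Let $\overline{\mathbb{Q}}$ denote the field of algebraic numbers, viewed as a subfield of $\mathbb{C}$ via a fixed embedding. Let $$\mathcal T := \overline{\mathbb{Q}}[\cos(\alpha),\sin(\alpha) : \alpha\in\overline{\mathbb{Q}}]\subseteq \mathbb C$$ be the $\overline{\mathbb{Q}}$-subalgebra of $\mathbb{C}$ generated by the values of cosine and sine at all algebraic points. Let $\mathcal A:=\overline{\mathbb{Q}}[(X_\alpha, Y_\alpha)_{\alpha\in\overline{\mathbb{Q}}}]$ be the polynomial ring over $\overline{\mathbb{Q}}$ in the countably many variables $X_\alpha, Y_\alpha$ ($\alpha\in\overline{\mathbb{Q}}$), and let $\mathrm{ev}:\mathcal A\to\mathcal T$ be the $\overline{\mathbb{Q}}$-algebra homomorphism determined by $\mathrm{ev}(X_\alpha)=\cos(\alpha)$ and $\mathrm{ev}(Y_\alpha)=\sin(\alpha)$ for all $\alpha\in\overline{\mathbb{Q}}$. Let $\mathfrak I$ be the ideal of $\mathcal A$ generated by all polynomials $$X_\alpha^2+Y_\alpha^2-1,\quad X_{\alpha+\beta}-X_\alpha X_\beta +Y_\alpha Y_\beta, \quad Y_{\alpha+\beta}-Y_\alpha X_\beta-X_\alpha Y_\beta,$$ for $\alpha,\beta\in\overline{\mathbb{Q}}$. Then $\mathfrak I\subseteq\ker(\mathrm{ev})$, and the induced $\overline{\mathbb{Q}}$-algebra homomorphism $\overline{\mathrm{ev}}:\mathcal A/\mathfrak I\to\mathcal T$ is an isomorphism; equivalently, $\ker(\mathrm{ev})=\mathfrak I$.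
   Context: Each element of $\mathcal A$ is a polynomial with algebraic coefficients in only finitely many of the variables $X_\alpha, Y_\alpha$. *)

(* Defs.v *)
From HB Require Import structures.
From Stdlib Require Import Reals.
From mathcomp Require Import all_boot all_order all_algebra.
From mathcomp Require Import algC.
From mathcomp Require Import finmap.
From mathcomp Require Import Rstruct.
From mathcomp Require Import complex.
From mathcomp.multinomials Require Import monalg.

Set Implicit Arguments.
Unset Strict Implicit.
Unset Printing Implicit Defensive.

Import GRing.Theory Num.Theory.
Local Open Scope ring_scope.
Local Open Scope complex_scope.

Notation CC := (R[i]).

Definition cexp (z : CC) : CC :=
  ((Rtrigo_def.exp (complex.Re z))%:C * ((Rtrigo_def.cos (complex.Im z)) +i* (Rtrigo_def.sin (complex.Im z)))).

Definition ccos (z : CC) : CC := (cexp ('i * z) + cexp (- ('i * z))) / 2%:R.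
Definition csin (z : CC) : CC := (cexp ('i * z) - cexp (- ('i * z))) / (2%:R * 'i).

(* Variables of A: (a, true) is X_a, (a, false) is Y_a, for a in Qbar = algC. *)
Definition var := (algC * bool)%type.

(* A = Qbar[(X_a, Y_a)_{a in Qbar}] : each element is a finitely supported
   algC-linear combination of finitely supported monomials. *)
Definition A := {malg algC[{cmonom var}]}.

Definition Xv (a : algC) : A := << ucm (a, true) >>.
Definition Yv (a : algC) : A := << ucm (a, false) >>.

Definition ev_var (iota : {rmorphism algC -> CC}) (v : var) : CC :=
  if v.2 then ccos (iota v.1) else csin (iota v.1).

Definition ev_monom (iota : {rmorphism algC -> CC}) (m : {cmonom var}) : CC :=
  \prod_(v <- finsupp m) ev_var iota v ^+ (m v).

Definition ev (iota : {rmorphism algC -> CC}) (P : A) : CC :=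
  mmap iota (ev_monom iota) P.

Definition is_generator (g : A) : Prop :=
  exists a b : algC,
    g = Xv a ^+ 2 + Yv a ^+ 2 - 1 \/
    g = Xv (a + b) - Xv a * Xv b + Yv a * Yv b \/
    g = Yv (a + b) - Yv a * Xv b - Xv a * Yv b.

Definition in_ideal (P : A) : Prop :=
  exists s : seq (A * A),
    (forall c, c \in s -> is_generator c.2) /\
    P = \sum_(c <- s) c.1 * c.2.

(* Main.v *)
Require Import Defs.
From HB Require Import structures.
From Stdlib Require Import Reals Lra Factorial.
From mathcomp Require Import all_boot all_order all_algebra algC finmap Rstruct complex.
From mathcomp.multinomials Require Import monalg.

(** Put [E_a := X_a + i Y_a].  Modulo the ideal, [E_(a+b) = E_a E_b] and
    [E_0 = 1], hence [X_a - i Y_a = E_(-a)], so every polynomial is congruent to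
    a linear combination of the [E_a].  As [E_a] evaluates to [exp (i a)], the
    theorem reduces to Lindemann-Weierstrass: exponentials of distinct algebraic
    numbers are linearly independent over the algebraic numbers.

    For the latter, multiply a relation [sum_i c_i exp a_i = 0] by its formal
    conjugates [sum_i s(c_i) exp s(a_i)], [s] ranging over a Galois group.  This
    gives a relation [sum_phi C_phi exp B_phi = 0] indexed by maps [phi] from the
    group to the indices, and the group permutes the pairs [(C_phi, B_phi)];
    comparing lexicographically largest exponents shows that it is not formally
    trivial.  Let [W] be the linear form on polynomials sending [q] to
    [sum_phi C_phi sum_j l^j q^(j) (l B_phi)], where [l B_phi] is integral.  The
    relation makes [W 'X^n] equal to minus a combination of Taylor remainders of
    [exp], hence of at most geometric growth.  With [Q] the product of the
    ['X - l B_phi] over distinct values and [p] a large prime, the number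
    [W (Q^(p-1) 'X^j) / (p-1)!] is a rational integer of absolute value less
    than 1, so it vanishes.  By linearity so does [W (Q^(p-1) h)] for
    [h := Q / ('X - g)]; but modulo [p!] it is [(p-1)!] times
    [d l^(p-1) h(g)^p], where [d] is the coefficient attached to the exponent
    [g / l].  Hence [p] divides a power of a fixed nonzero algebraic integer. *)

Set Implicit Arguments.
Unset Strict Implicit.
Unset Printing Implicit Defensive.

Import Order.TTheory GRing.Theory Num.Theory.

(** * Taylor remainders of the exponential *)

Section ExpRemainder.
Local Open Scope R_scope.
Variables x y : R.

(* real part of [(a + b i) (x + y i) ^ k] *)
Fixpoint re_mul_pow (k : nat) (a b : R) : R :=
  if k is S k' then re_mul_pow k' (a * x - b * y) (a * y + b * x) else a.

(** The real part of [a + b i] times the [n]-term Taylor polynomial of [exp (t (x + y i))]. Working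
    with real parts lets the mean value theorem in [t] apply. *)
Fixpoint re_taylor (n : nat) (a b t : R) : R :=
  if n is S n' then re_taylor n' a b t + t ^ n' / INR (fact n') * re_mul_pow n' a b
  else 0.

Let M := sqrt (x * x + y * y).

Lemma re_taylor0 n a b : re_taylor (S n) a b 0 = a.
Proof.
elim: n => [|n IH] /=; first by field.
by move: IH => /= ->; rewrite Rmult_0_l; unfold Rdiv; ring.
Qed.

Lemma re_taylor_deriv n a b t :
  derivable_pt_lim (re_taylor (S n) a b) t
    (re_taylor n (a * x - b * y) (a * y + b * x) t).
Proof.
elim: n => [|n IH].
  have -> : re_taylor 0 (a * x - b * y) (a * y + b * x) t = 0 by [].
  apply: (derivable_pt_lim_ext (fun _ => a)); last exact: derivable_pt_lim_const.
  by move=> u /=; field.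
have fn0 := INR_fact_neq_0 n; have fn1 := INR_fact_neq_0 (S n).
have Sn0 : INR (S n) <> 0 by apply: not_0_INR.
have E : re_taylor (S n) (a * x - b * y) (a * y + b * x) t =
   re_taylor n (a * x - b * y) (a * y + b * x) t +
   (/ INR (fact (S n)) * re_mul_pow (S n) a b) * (INR (S n) * t ^ n).
  rewrite [LHS]/=; congr (_ + _).
  rewrite [re_mul_pow (S n) a b]/= (fact_simpl n) mult_INR.
  by field.
rewrite E.
apply: (derivable_pt_lim_ext (fun u => re_taylor (S n) a b u +
   (/ INR (fact (S n)) * re_mul_pow (S n) a b) * u ^ S n)).
  by move=> u; rewrite [RHS]/= -/(re_taylor (S n) a b u); unfold Rdiv; simpl; ring.
apply: derivable_pt_lim_plus; first exact: IH.
apply: derivable_pt_lim_scal; exact: (derivable_pt_lim_pow t (S n)).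
Qed.

Lemma re_exp_deriv a b t :
  derivable_pt_lim
    (fun t => exp (t * x) * (a * cos (t * y) - b * sin (t * y))) t
    (exp (t * x) * ((a * x - b * y) * cos (t * y) - (a * y + b * x) * sin (t * y))).
Proof.
have Dl c : derivable_pt_lim (fun t => t * c) t c.
  apply: (derivable_pt_lim_ext (mult_real_fct c id)).
    by move=> u; rewrite /mult_real_fct /id Rmult_comm.
  have -> : c = c * 1 :> R by ring.
  rewrite {1}Rmult_1_r.
  exact/derivable_pt_lim_scal/derivable_pt_lim_id.
have De : derivable_pt_lim (fun t => exp (t * x)) t (exp (t * x) * x).
  exact: (derivable_pt_lim_comp (fun t => t * x) exp t _ _ (Dl x) (derivable_pt_lim_exp _)).
have Dc : derivable_pt_lim (fun t => cos (t * y)) t (- sin (t * y) * y).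
  exact: (derivable_pt_lim_comp (fun t => t * y) cos t _ _ (Dl y) (derivable_pt_lim_cos _)).
have Ds : derivable_pt_lim (fun t => sin (t * y)) t (cos (t * y) * y).
  exact: (derivable_pt_lim_comp (fun t => t * y) sin t _ _ (Dl y) (derivable_pt_lim_sin _)).
have := derivable_pt_lim_mult _ _ _ _ _ De
  (derivable_pt_lim_minus _ _ _ _ _ (derivable_pt_lim_scal _ a _ _ Dc)
                                    (derivable_pt_lim_scal _ b _ _ Ds)).
rewrite /mult_fct /minus_fct /mult_real_fct => D.
match type of D with derivable_pt_lim _ _ ?l =>
  match goal with |- derivable_pt_lim _ _ ?r => have -> : r = l by ring end end.
exact: D.
Qed.

(** The trigonometric factor is at most the modulus of [a + b i] by Cauchy-Schwarz, and [x] is at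
    most the modulus [M]. *)
Lemma re_exp_bound a b t : 0 <= t ->
  exp (t * x) * (a * cos (t * y) - b * sin (t * y)) <=
    sqrt (a * a + b * b) * exp (t * M).
Proof.
move=> t0.
have M0 : 0 <= M := sqrt_pos _.
have xM : x <= M.
  case: (Rle_dec x 0) => x0; first lra.
  rewrite -[x]sqrt_square; last lra.
  by apply: sqrt_le_1_alt; nra.
have CS : a * cos (t * y) - b * sin (t * y) <= sqrt (a * a + b * b).
  set q := _ - _; case: (Rle_dec q 0) => q0.
    by apply: Rle_trans q0 (sqrt_pos _).
  rewrite -[q]sqrt_square; last lra.
  apply: sqrt_le_1_alt.
  have := sin2_cos2 (t * y); rewrite /Rsqr /q => cs1.
  have := Rle_0_sqr (a * sin (t * y) + b * cos (t * y)); rewrite /Rsqr => H.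
  nra.
have e1 : exp (t * x) <= exp (t * M).
  have : t * x <= t * M by nra.
  by case=> [/exp_increasing|->]; lra.
have e0 := exp_pos (t * x); have s0 := sqrt_pos (a * a + b * b).
nra.
Qed.

(* Quantifying over the multiplier [a + b i] lets the induction on [n] absorb
   the factor [z] that differentiation in [t] produces. *)
Lemma re_exp_taylor_bound n a b t : 0 <= t ->
  exp (t * x) * (a * cos (t * y) - b * sin (t * y)) - re_taylor n a b t <=
    sqrt (a * a + b * b) * M ^ n * (t ^ n / INR (fact n)) * exp (t * M).
Proof.
have M0 : 0 <= M := sqrt_pos _.
elim: n a b t => [|n IH] a b t t0.
  rewrite [re_taylor _ _ _ _]/= /= Rdiv_1_r !Rmult_1_r Rminus_0_r.
  exact: re_exp_bound.
set a' := a * x - b * y; set b' := a * y + b * x.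
have sE : sqrt (a' * a' + b' * b') = sqrt (a * a + b * b) * M.
  by rewrite /M -sqrt_mult_alt; [congr sqrt; rewrite /a' /b'; ring | nra].
have fn1 := INR_fact_neq_0 (S n); have fn0 := INR_fact_neq_0 n.
have Sn0 : INR (S n) <> 0 by apply: not_0_INR.
set c := sqrt (a * a + b * b) * M ^ S n / INR (fact (S n)).
(* [h] is the claimed bound minus the remainder. It vanishes at 0, and in [h'] the term with
   [INR (S n) * t ^ n] already dominates, by the induction hypothesis for [a'] and [b']. *)
pose h t := c * (t ^ S n * exp (t * M)) -
   (exp (t * x) * (a * cos (t * y) - b * sin (t * y)) - re_taylor (S n) a b t).
pose h' t := c * (INR (S n) * t ^ n * exp (t * M) + t ^ S n * (exp (t * M) * M)) -
   (exp (t * x) * (a' * cos (t * y) - b' * sin (t * y)) - re_taylor n a' b' t).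
have c0 : 0 <= c.
  apply: Rmult_le_pos; last exact/Rlt_le/Rinv_0_lt_compat/INR_fact_lt_0.
  by apply: Rmult_le_pos (sqrt_pos _) _; apply: pow_le.
have Dh u : derivable_pt_lim h u (h' u).
  apply: derivable_pt_lim_minus; last first.
    by apply: derivable_pt_lim_minus; [exact: re_exp_deriv | exact: re_taylor_deriv].
  apply: derivable_pt_lim_scal; apply: derivable_pt_lim_mult.
    exact: (derivable_pt_lim_pow u (S n)).
  apply: (derivable_pt_lim_comp (fun t => t * M) exp); last exact: derivable_pt_lim_exp.
  apply: (derivable_pt_lim_ext (mult_real_fct M id)).
    by move=> v; rewrite /mult_real_fct /id Rmult_comm.
  have {2}-> : M = M * 1 by ring.
  exact/derivable_pt_lim_scal/derivable_pt_lim_id.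
have h'0 u : 0 <= u -> 0 <= h' u.
  move=> u0; have := IH a' b' u u0; rewrite sE => IHu.
  have cE : c * (INR (S n) * u ^ n * exp (u * M)) =
      sqrt (a * a + b * b) * M * M ^ n * (u ^ n / INR (fact n)) * exp (u * M).
    by rewrite /c (fact_simpl n) mult_INR /=; field.
  have : 0 <= c * (u ^ S n * (exp (u * M) * M)).
    apply: Rmult_le_pos => //; apply: Rmult_le_pos; first exact: pow_le.
    by apply: Rmult_le_pos => //; apply/Rlt_le/exp_pos.
  rewrite /h' Rmult_plus_distr_l cE; lra.
have h0 : h 0 = 0.
  rewrite /h re_taylor0 !Rmult_0_l exp_0 cos_0 sin_0 /=; ring.
have ht : 0 <= h t.
  case: (Rle_lt_or_eq_dec _ _ t0) => [tp | <-]; last by rewrite h0; lra.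
  have [u [E [u0 ut]]] := MVT_cor2 h h' 0 t tp (fun c _ => Dh c).
  have := h'0 u (Rlt_le _ _ u0); rewrite h0 in E; nra.
move: ht; rewrite /h /c.
set l := (_ / _) * _; set r := _ * exp _; have -> : l = r; last by lra.
by rewrite /l /r; field.
Qed.

End ExpRemainder.

(* Loaded only here: these tactics shadow the [ring] and [field] of Stdlib. *)
From mathcomp Require Import ring.
From mathcomp Require Import all_fingroup all_field.

Import complex.ComplexField.Normc.
Local Open Scope ring_scope.
Local Open Scope complex_scope.
Local Notation Re := (@complex.Re R).
Local Notation Im := (@complex.Im R).
Local Notation normc := (@normc R).
Local Notation "x ^*" := (@conjc R x).

Lemma re_mul_powE (z u : CC) k :
  re_mul_pow (Re z) (Im z) k (Re u) (Im u) = Re (u * z ^+ k).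
Proof.
elim: k u => [|k IH] u; first by rewrite expr0 mulr1.
rewrite exprS mulrA -IH; case: u z {IH} => a b [x y] /=.
by congr re_mul_pow.
Qed.

(** * Complex form of the remainder estimate *)

Lemma re_taylorE (z u : CC) n :
  re_taylor (Re z) (Im z) n (Re u) (Im u) 1 =
    Re (u * \sum_(k < n) z ^+ k / k`!%:R).
Proof.
elim: n => [|n IH]; first by rewrite big_ord0 mulr0.
rewrite big_ord_recr mulrDr /= {}IH re_mul_powE RdivE RmultE RplusE.
rewrite RpowE expr1n INRE factE mulrA.
have -> : (n`!%:R : CC)^-1 = ((n`!%:R : R)^-1)%:C by rewrite fmorphV rmorph_nat.
case: (u * _) (u * _) => [a b] [c d] /=.
ring.
Qed.

Lemma cexpE (z u : CC) :
  Re (u * cexp z) =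
    exp (Re z) * (Re u * Rtrigo_def.cos (Im z) - Im u * Rtrigo_def.sin (Im z)).
Proof.
rewrite /cexp; case: u z => [a b] [x y] /=.
by ring.
Qed.

Lemma normc_ge0 (z : CC) : 0 <= normc z.
Proof. by case: z => a b; apply: sqrtr_ge0. Qed.

(** Apply the real estimate at [t = 1] with the conjugate of the remainder [w] as multiplier: the
    left side becomes [normc w ^+ 2], and one factor [normc w] cancels. *)
Lemma cexp_taylor (z : CC) n :
  normc (cexp z - \sum_(k < n) z ^+ k / k`!%:R) <=
    normc z ^+ n / n`!%:R * exp (normc z).
Proof.
set w := _ - _.
have [/eqP/eq0_normc w0|w_neq0] := boolP (normc w == 0).
  rewrite w0 normc0 mulr_ge0 ?divr_ge0 ?exprn_ge0 ?ler0n ?normc_ge0 //.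
  by apply/RleP/Rlt_le/exp_pos.
have w_gt0 : 0 < normc w by rewrite lt_def w_neq0 normc_ge0.
have /RleP := re_exp_taylor_bound (Re z) (Im z) n (Re w^*) (Im w^*) Rle_0_1.
have sqE (v : CC) : sqrt (Re v * Re v + Im v * Im v) = normc v.
  by case: v => a b; rewrite RsqrtE /= !expr2.
rewrite re_taylorE !sqE !RdivE !RmultE !RpowE !expr1n !mul1r INRE factE.
rewrite -cexpE RminusE.
have <- : Re (w^* * w) = Re (w^* * cexp z) - Re (w^* * \sum_(k < n) z ^+ k / k`!%:R).
  by rewrite -raddfB -mulrBr.
have -> : Re (w^* * w) = normc w ^+ 2.
  case: (w) => a b /=; rewrite sqr_sqrtr ?addr_ge0 ?sqr_ge0 //; ring.
have -> : normc w^* = normc w by case: (w) => a b /=; rewrite sqrrN.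
by rewrite expr2 -!mulrA ler_pM2l.
Qed.

Lemma normcD (x y : CC) : normc (x + y) <= normc x + normc y.
Proof. exact: le_normcD. Qed.

Lemma normc_sum (I : Type) (r : seq I) (P : pred I) (F : I -> CC) :
  normc (\sum_(i <- r | P i) F i) <= \sum_(i <- r | P i) normc (F i).
Proof.
elim/big_ind2: _ => [|x1 x2 y1 y2 le1 le2|//]; first by rewrite normc0.
by apply: le_trans (normcD _ _) _; apply: lerD.
Qed.

Lemma normcX (x : CC) n : normc (x ^+ n) = normc x ^+ n.
Proof. by elim: n => [|n IH]; rewrite ?expr0 ?normc1 // !exprS normcM IH. Qed.

Lemma normc_int (z : int) : normc z%:~R = `|z%:~R|.
Proof.
have -> : (z%:~R : CC) = (z%:~R : R)%:C by rewrite rmorph_int.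
by rewrite /= expr0n addr0 sqrtr_sqr.
Qed.

Lemma normc_nat n : normc n%:R = n%:R.
Proof. by rewrite pmulrn normc_int -pmulrn normr_nat. Qed.

Lemma exp_lt_fact (c A : R) : 0 <= c -> 0 <= A ->
  exists m0 : nat, forall m, (m0 <= m)%N -> c * A ^+ m < m`!%:R.
Proof.
move=> c0 A0.
(* The tolerance is [1 / (c + 1)] rather than [1 / c] so that [c = 0] is covered. *)
have e0 : Rlt 0 (Rinv (c + 1)).
  by apply/Rinv_0_lt_compat/RltP; rewrite ltr_wpDl.
have [m0 H] := cv_speed_pow_fact A _ e0.
exists m0 => m m0m.
have := H m (elimT ssrnat.leP m0m).
rewrite /Rdist Rminus_0_r Rabs_right; last first.
  apply/Rle_ge/RleP; rewrite RdivE RpowE INRE factE.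
  by rewrite divr_ge0 ?exprn_ge0 // ler0n.
move/RltP; rewrite RdivE RpowE INRE factE RinvE.
have f0 : 0 < m`!%:R :> R by rewrite ltr0n fact_gt0.
have c1 : 0 < c + 1 by rewrite ltr_wpDl.
rewrite ltr_pdivrMr // mulrC ltr_pdivlMr // => lt.
apply: le_lt_trans lt; rewrite mulrC ler_wpM2l ?exprn_ge0 //.
by rewrite lerDl ler01.
Qed.

(** If [x] is a root of a monic rational [p] of degree [n], then [N x] is a root of the monic [q]
    with coefficients [p_i N^(n-i)]. Below the top degree at least one factor [N] is present to
    clear the denominator. *)
Lemma Aint_denom (x : algC) : exists2 N : nat, (0 < N)%N & N%:R * x \in Aint.
Proof.
have [p [Dp mon_p] _] := minCpolyP x.
have px0 : root (map_poly ratr p) x by rewrite -Dp root_minCpoly.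
pose D : int := \prod_(i < size p) denq p`_i.
have D0 : D != 0 by apply/prodf_neq0 => i _; rewrite denq_neq0.
pose N := `|D|%N.
have N0 : (0 < N)%N by rewrite absz_gt0.
exists N => //.
have pD i : N%:R * (ratr p`_i : algC) \in Num.int.
  have [ge_i|lt_i] := leqP (size p) i.
    by rewrite nth_default // rmorph0 mulr0 rpred0.
  have -> : N%:R = ((-1) ^+ (D < 0)%R * D)%:~R :> algC by rewrite pmulrn abszE normrEsign.
  rewrite rmorphM /= -mulrA rpredM ?rpred_int // /D (bigD1 (Ordinal lt_i)) //=.
  rewrite rmorphM /= mulrAC rpredM ?rpred_int //.
  rewrite -{2}[p`_i]divq_num_den rmorphM fmorphV /= !ratr_int mulrC divfK ?rpred_int //.
  by rewrite intr_eq0 denq_neq0.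
have n0 : (0 < size p)%N by rewrite size_poly_gt0 monic_neq0.
pose n := (size p).-1.
have szp : size p = n.+1 by rewrite prednK.
pose q := \poly_(i < n.+1) ((ratr p`_i : algC) * N%:R ^+ (n - i)).
have pn : ratr p`_n = 1 :> algC.
  by move/monicP: mon_p; rewrite /lead_coef -/n => ->; rewrite rmorph1.
have qn : q`_n = 1 by rewrite coef_poly ltnSn subnn mulr1.
have szq : size q = n.+1.
  by rewrite size_poly_eq //= pn subnn mul1r oner_neq0.
apply: (@root_monic_Aint q).
- rewrite /root horner_coef szq.
  have -> : \sum_(i < n.+1) q`_i * (N%:R * x) ^+ i =
    N%:R ^+ n * (map_poly ratr p).[x].
    rewrite horner_coef size_map_poly szp mulr_sumr; apply: eq_bigr => i _.
    rewrite coef_poly ltn_ord coef_map exprMn.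
    have -> : N%:R ^+ n = N%:R ^+ (n - i) * N%:R ^+ i :> algC.
      by rewrite -exprD subnK // -ltnS.
    by rewrite /=; ring.
  by move/eqP: px0 => ->; rewrite mulr0.
- by rewrite monicE /lead_coef szq /= qn.
- apply/polyOverP => i; rewrite coef_poly; case: ifP => i_n; last exact: rpred0.
  move: i_n; rewrite ltnS leq_eqVlt => /predU1P[->|lt_in].
    by move: qn; rewrite coef_poly ltnSn => ->; rewrite rpred1.
  by rewrite -(subnSK lt_in) exprS mulrCA mulrA rpredM ?pD // rpredX // rpred_nat.
Qed.

(** * The Hermite functional *)

Section Hermite.
Variable K : fieldType.

(* [\sum_j l ^+ j * p^`(j).[0]] *)
Definition fact_eval (l : K) (p : {poly K}) : K :=
  \sum_(j < size p) p`_j * (j`!%:R * l ^+ j).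

Lemma fact_evalE l N (p : {poly K}) : (size p <= N)%N ->
  fact_eval l p = \sum_(j < N) p`_j * (j`!%:R * l ^+ j).
Proof.
move=> le_pN; rewrite /fact_eval.
rewrite (big_ord_widen _ (fun j => p`_j * (j`!%:R * l ^+ j)) le_pN).
rewrite big_mkcond; apply: eq_bigr => i _; case: ltnP => // le_i.
by rewrite nth_default // mul0r.
Qed.

Lemma fact_eval_is_linear l : linear_for *%R (fact_eval l).
Proof.
move=> a p q; set N := maxn (size p) (size q).
have le_p : (size p <= N)%N by apply: leq_maxl.
have le_q : (size q <= N)%N by apply: leq_maxr.
have le_s : (size (a *: p + q)%R <= N)%N.
  apply: leq_trans (size_polyD _ _) _; rewrite geq_max le_q andbT.
  exact: leq_trans (size_scale_leq _ _) le_p.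
rewrite (fact_evalE _ le_p) (fact_evalE _ le_q) (fact_evalE _ le_s).
rewrite mulr_sumr -big_split; apply: eq_bigr => j _ /=.
by rewrite coefD coefZ mulrDl mulrA.
Qed.

HB.instance Definition _ l := GRing.isLinear.Build K {poly K} K *%R (fact_eval l)
  (fact_eval_is_linear l).

Lemma fact_evalXn l n : fact_eval l 'X^n = n`!%:R * l ^+ n.
Proof.
rewrite (@fact_evalE _ n.+1) ?size_polyXn // big_ord_recr big1 /= => [|i _].
  by rewrite coefXn eqxx mul1r add0r.
by rewrite coefXn (ltn_eqF (ltn_ord i)) mul0r.
Qed.

(** This is where the exponential enters: since [C(n,i) (n-i)! = n! / i!], the binomial expansion
    turns into a Taylor polynomial of [exp b]. *)
Lemma fact_evalXDn l b n : (forall k : nat, k`!%:R != 0 :> K) ->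
  fact_eval l (('X + (l * b)%:P) ^+ n) =
    l ^+ n * n`!%:R * \sum_(k < n.+1) b ^+ k / k`!%:R.
Proof.
move=> f0; rewrite exprDn raddf_sum mulr_sumr; apply: eq_bigr => i _.
rewrite raddfMn -rmorphXn /= mulrC mul_polyC linearZ /= fact_evalXn exprMn.
have lei : (i <= n)%N by rewrite -ltnS.
have -> : l ^+ n = l ^+ (n - i) * l ^+ i by rewrite -exprD subnK.
rewrite -(bin_fact lei) !natrM -mulr_natr.
by field; exact: f0.
Qed.

Lemma fact_eval_map (s : {rmorphism K -> K}) l p : s l = l ->
  s (fact_eval l p) = fact_eval l (map_poly s p).
Proof.
move=> sl; rewrite /fact_eval size_map_poly rmorph_sum; apply: eq_bigr => j _.
by rewrite !rmorphM rmorphXn /= sl rmorph_nat coef_map.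
Qed.

Lemma coef_shift_root (g : K) m u j :
  ((('X - g%:P) ^+ m * u) \Po ('X + g%:P))`_j =
    if (j < m)%N then 0 else (u \Po ('X + g%:P))`_(j - m).
Proof.
rewrite comp_polyM rmorphXn /= comp_polyB comp_polyX comp_polyC addrK.
by rewrite coefXnM.
Qed.

Lemma coef0_shift (u : {poly K}) g : (u \Po ('X + g%:P))`_0 = u.[g].
Proof. by rewrite -horner_coef0 horner_comp hornerD hornerX hornerC add0r. Qed.

Variable f : {rmorphism K -> algC}.

Definition Kint : {pred K} := fun x => f x \in Aint.

Lemma KintE x : (x \in Kint) = (f x \in Aint).
Proof. by []. Qed.

Lemma Kint_subring : subring_closed Kint.
Proof.
split=> [|x y|x y]; rewrite !KintE; first by rewrite rmorph1.
  by rewrite rmorphB; apply: rpredB.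
by rewrite rmorphM; apply: rpredM.
Qed.

HB.instance Definition _ := GRing.isSubringClosed.Build _ Kint Kint_subring.

(** For [j > m] the factorial [j!] is an integer multiple of [(m+1)!], so only the term of degree
    [m] needs to be kept apart. *)
Lemma fact_eval_int l m (p : {poly K}) : l \in Kint -> p \is a polyOver Kint ->
    (forall j, (j < m)%N -> p`_j = 0) ->
  exists2 y, y \in Kint &
    fact_eval l p = m`!%:R * l ^+ m * p`_m + (m.+1)`!%:R * y.
Proof.
move=> intl intp p0.
have le_p : (size p <= m.+1 + size p)%N by apply: leq_addl.
exists (\sum_(j < size p) p`_(m.+1 + j) *
    (('C(m.+1 + j, m.+1) * j`!)%:R * l ^+ (m.+1 + j))).
  by apply: rpred_sum => j _; rewrite !rpredM ?rpredX ?rpred_nat ?(polyOverP intp).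
rewrite (fact_evalE _ le_p) big_split_ord big_ord_recr /=.
rewrite [X in X + _ + _]big1 ?add0r => [|j _]; last by rewrite p0 ?mul0r.
congr (_ + _); first by rewrite mulrC.
rewrite mulr_sumr; apply: eq_bigr => j _.
by rewrite -(bin_fact (leq_addr j m.+1)) addKn !natrM; ring.
Qed.

Section Functional.
Variables (J : finType) (C G : J -> K) (l : K).

(** The form [W] of the introduction, an algebraic substitute for Hermite's integrals: shifting by
    [G i] turns derivatives at [G i] into coefficients. *)
Definition hermite (q : {poly K}) : K :=
  \sum_i C i * fact_eval l (q \Po ('X + (G i)%:P)).

Lemma hermite_is_linear : linear_for *%R hermite.
Proof.
move=> a p q; rewrite /hermite mulr_sumr -big_split; apply: eq_bigr => i _ /=.
by rewrite comp_polyD comp_polyZ linearD linearZ /= mulrDr mulrCA.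
Qed.

HB.instance Definition _ := GRing.isLinear.Build K {poly K} K *%R hermite hermite_is_linear.

(** Used to see that [W] takes a polynomial fixed by the conjugations to a fixed value. *)
Lemma hermite_map (s : {rmorphism K -> K}) (t : J -> J) q : bijective t ->
    s l = l -> (forall i, s (C i) = C (t i)) -> (forall i, s (G i) = G (t i)) ->
  s (hermite q) = hermite (map_poly s q).
Proof.
move=> bij_t sl sC sG; rewrite /hermite rmorph_sum.
rewrite [RHS](reindex t); last exact: onW_bij.
apply: eq_bigr => i _; rewrite rmorphM sC fact_eval_map //= map_comp_poly.
by rewrite rmorphD /= map_polyX map_polyC /= sG.
Qed.

(** Serves twice: [W q / m!] is integral, and modulo [m.+1], later a prime, it is an explicit sum
    over the roots. *)
Lemma hermite_int m q : l \in Kint -> (forall i, C i \in Kint) ->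
    (forall i, G i \in Kint) -> q \is a polyOver Kint ->
    (forall i, exists u, q = ('X - (G i)%:P) ^+ m * u) ->
  exists2 y, y \in Kint & hermite q =
    m`!%:R * (\sum_i C i * l ^+ m * (q \Po ('X + (G i)%:P))`_m + m.+1%:R * y).
Proof.
move=> intl intC intG intq rootq.
have H i : exists2 y, y \in Kint & fact_eval l (q \Po ('X + (G i)%:P)) =
    m`!%:R * l ^+ m * (q \Po ('X + (G i)%:P))`_m + (m.+1)`!%:R * y.
  apply: fact_eval_int => // [|j lt_jm].
    by rewrite polyOver_comp // rpredD ?polyOverX ?polyOverC.
  by have [u ->] := rootq i; rewrite coef_shift_root lt_jm.
have [y inty yE] := fin_all_exists2 H.
exists (\sum_i C i * y i); first by apply: rpred_sum => i _; rewrite rpredM.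
rewrite /hermite mulrDr !mulr_sumr -big_split; apply: eq_bigr => i _ /=.
by rewrite yE factS natrM; ring.
Qed.

Variable (k : {rmorphism K -> CC}).

(** Subtracting [l^n n!] times the relation replaces each Taylor polynomial by a remainder of order
    [n.+1], whose denominator [(n+1)!] absorbs [n!]. *)
Lemma hermite_bound (B : J -> K) (ln : nat) :
    (forall k : nat, k`!%:R != 0 :> K) ->
    l = ln%:R -> (forall i, G i = l * B i) ->
    \sum_i k (C i) * cexp (k (B i)) = 0 ->
  exists c r : R, [/\ 0 <= c, 0 <= r & 
    forall n, normc (k (hermite 'X^n)) <= c * r ^+ n].
Proof.
move=> f0 lE GE rel.
pose M := \sum_i normc (k (B i)).
have leM i : normc (k (B i)) <= M.
  by rewrite /M (bigD1 i) //= lerDl sumr_ge0 // => *; apply: normc_ge0.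
have M0 : 0 <= M by rewrite sumr_ge0 // => *; apply: normc_ge0.
have exp_ge0 x : 0 <= exp x by apply/RleP/Rlt_le/exp_pos.
exists (\sum_i normc (k (C i)) * (M * exp M)), (ln%:R * M); split.
- by rewrite sumr_ge0 // => i _; rewrite !mulr_ge0 ?normc_ge0.
- by rewrite mulr_ge0 ?ler0n.
move=> n.
have kE : k (hermite 'X^n) = \sum_i k (C i) * (ln%:R ^+ n * n`!%:R *
   - (cexp (k (B i)) - \sum_(j < n.+1) k (B i) ^+ j / j`!%:R)).
  transitivity (k (hermite 'X^n) - ln%:R ^+ n * n`!%:R *
     (\sum_i k (C i) * cexp (k (B i)))); first by rewrite rel mulr0 subr0.
  rewrite rmorph_sum mulr_sumr -sumrB; apply: eq_bigr => i _.
  rewrite comp_Xn_poly GE fact_evalXDn // !rmorphM rmorphXn rmorph_nat /= lE rmorph_nat.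
  rewrite rmorph_sum opprB.
  under [in LHS]eq_bigr do rewrite fmorph_div rmorphXn rmorph_nat.
  by ring.
rewrite kE; apply: le_trans (normc_sum _ _ _) _.
rewrite mulr_suml; apply: ler_sum => i _.
rewrite normcM -[leRHS]mulrA ler_wpM2l ?normc_ge0 // !normcM normcN normcX !normc_nat.
have := cexp_taylor (k (B i)) n.+1.
move/(ler_wpM2l (_ : 0 <= ln%:R ^+ n * n`!%:R :> R)) => le1.
apply: le_trans (le1 _) _; first by rewrite mulr_ge0 ?exprn_ge0 ?ler0n.
have -> : M * exp M * (ln%:R * M) ^+ n = ln%:R ^+ n * (M ^+ n.+1 * exp M).
  by rewrite exprMn exprS; ring.
rewrite -[leLHS]mulrA ler_wpM2l ?exprn_ge0 ?ler0n // [leLHS]mulrA.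
apply: ler_pM => //; rewrite ?mulr_ge0 ?divr_ge0 ?exprn_ge0 ?ler0n ?normc_ge0 //.
  by rewrite invr_ge0 ler0n.
  set z := normc _; apply: le_trans (_ : z ^+ n.+1 <= _); last first.
    by apply: lerXn2r (leM i); rewrite ?nnegrE ?normc_ge0.
  rewrite mulrCA; apply: ler_piMr; first by rewrite exprn_ge0 // normc_ge0.
  rewrite ler_pdivrMr ?ltr0n ?fact_gt0 // mul1r ler_nat.
  by rewrite factS leq_pmull.
apply/RleP; have /RleP[lt|->] := leM i.
  exact/Rlt_le/exp_increasing.
exact: Rle_refl.
Qed.

End Functional.

(** Expand one factor [Q] at a time. Each costs at most [A], the sum of [normc (k Q_i) r^i]; keeping
    [n] general lets the shifted monomials fall under the induction hypothesis. *)
Lemma functional_bound (W : {linear {poly K} -> K | *%R}) (k : {rmorphism K -> CC})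
    (c r : R) (Q : {poly K}) :
    0 <= c -> 0 <= r -> (forall n, normc (k (W 'X^n)) <= c * r ^+ n) ->
  exists2 A, 0 <= A & forall m n, normc (k (W (Q ^+ m * 'X^n))) <= c * A ^+ m * r ^+ n.
Proof.
move=> c0 r0 Wle; exists (\sum_(i < size Q) normc (k Q`_i) * r ^+ i).
  by rewrite sumr_ge0 // => i _; rewrite mulr_ge0 ?normc_ge0 ?exprn_ge0.
elim=> [|m IH] n; first by rewrite !expr0 mul1r mulr1.
have -> : Q ^+ m.+1 * 'X^n = \sum_(i < size Q) Q`_i *: (Q ^+ m * 'X^(n + i)).
  rewrite exprSr -mulrA -{2}[Q]coefK poly_def mulr_suml mulr_sumr; apply: eq_bigr => i _.
  by rewrite -scalerAl -exprD addnC scalerAr.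
rewrite linear_sum rmorph_sum; apply: le_trans (normc_sum _ _ _) _.
rewrite exprS mulrCA mulr_suml mulr_suml; apply: ler_sum => i _.
rewrite linearZ /= rmorphM normcM -!mulrA ler_wpM2l ?normc_ge0 //.
apply: le_trans (IH _) _; rewrite exprD le_eqVlt; apply/orP; left.
by apply/eqP; ring.
Qed.

End Hermite.

(** * Exponential relations permuted by conjugation *)

Section Conjugates.
Variables (K : fieldType) (f : {rmorphism K -> algC}) (k : {rmorphism K -> CC}).
Variable Gal : {rmorphism K -> K} -> Prop.
Hypothesis fixed_rat : forall x, (forall s, Gal s -> s x = x) -> f x \in Crat.

Lemma Gal_fixed_int x : (forall s, Gal s -> s x = x) -> x \in Kint f ->
  exists z : int, x = z%:~R.
Proof.
move=> fix_x int_x; have /intrP[z fx] := Cint_rat_Aint (fixed_rat fix_x) int_x.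
by exists z; apply: (fmorph_inj f); rewrite fx rmorph_int.
Qed.

Lemma natr_neq0 n : (0 < n)%N -> n%:R != 0 :> K.
Proof. by move=> n0; rewrite -(fmorph_eq0 f) rmorph_nat pnatr_eq0 -lt0n. Qed.

Variables (J : finType).

Lemma hermite_conjugates_int (C B : J -> K) (ln : nat) (b0 : K) :
    (forall s, Gal s -> exists2 t : J -> J, bijective t &
       forall i, s (C i) = C (t i) /\ s (B i) = B (t i)) ->
    (0 < ln)%N -> (forall i, C i \in Kint f) -> (forall i, ln%:R * B i \in Kint f) ->
    \sum_i k (C i) * cexp (k (B i)) = 0 ->
  \sum_(i | B i == b0) C i = 0.
Proof.
move=> Gal_perm ln0 intC intG rel.
set d := \sum_(i | _) _; apply/eqP/negPn/negP => d0.
pose l : K := ln%:R; pose G i := l * B i; pose g0 := l * b0.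
have l0 : l != 0 by apply: natr_neq0.
have intl : l \in Kint f by rewrite rpred_nat.
have fact0 n : n`!%:R != 0 :> K by rewrite natr_neq0 ?fact_gt0.
pose W := hermite C G l.
(* Without repetitions the roots of [Q] are simple, so the cofactor [h] below does not vanish at
   [g0]. *)
pose S := undup [seq G i | i <- enum J].
have S_G i : G i \in S by rewrite mem_undup map_f ?mem_enum.
have intS : {in S, forall g, g \in Kint f}.
  by move=> g; rewrite mem_undup => /mapP[i _ ->]; apply: intG.
have [i0 Bi0] : exists i0, B i0 = b0.
  have [/existsP[i /eqP]|/existsPn nB] := boolP [exists i, B i == b0]; first by exists i.
  by case/eqP: d0; rewrite /d big1 // => i Bi; have := nB i; rewrite Bi.
have Sg0 : g0 \in S by rewrite /g0 -Bi0 S_G.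
pose Q : {poly K} := \prod_(g <- S) ('X - g%:P).
pose h : {poly K} := \prod_(g <- rem g0 S) ('X - g%:P).
have QE : Q = ('X - g0%:P) * h by rewrite /Q (big_rem _ Sg0).
have uS : uniq S by apply: undup_uniq.
have intQ : Q \is a polyOver (Kint f).
  by rewrite /Q big_seq rpred_prod // => g Sg; rewrite polyOverXsubC intS.
have inth : h \is a polyOver (Kint f).
  rewrite /h big_seq rpred_prod // => g Sg; rewrite polyOverXsubC intS //.
  exact: mem_rem Sg.
have h0 : h.[g0] != 0.
  by rewrite -/(root h g0) root_prod_XsubC mem_rem_uniq // inE eqxx.
have rootQ i : exists u, Q = ('X - (G i)%:P) * u.
  by exists (\prod_(g <- rem (G i) S) ('X - g%:P)); rewrite /Q (big_rem _ (S_G i)).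
(* A conjugation maps the finite set [S] injectively into itself, hence permutes the roots of
   [Q]. *)
have galQ s : Gal s -> map_poly s Q = Q.
  move=> /Gal_perm[t bij_t tE].
  rewrite /Q rmorph_prod.
  under eq_bigr do rewrite rmorphB /= map_polyX map_polyC /=.
  rewrite -(big_map s xpredT (fun g => 'X - g%:P)); apply: perm_big.
  have sG i : s (G i) = G (t i) by rewrite rmorphM rmorph_nat (tE i).2.
  have us : uniq (map s S) by rewrite map_inj_uniq //; apply: fmorph_inj.
  have subS : {subset map s S <= S}.
    by move=> y /mapP[g + ->]; rewrite mem_undup => /mapP[i _ ->]; rewrite sG.
  by have [|_ eqS] := uniq_min_size us subS; rewrite ?size_map //; apply: uniq_perm.
pose n := size S.
have [c [r [c0 r0 Wle]]] := hermite_bound fact0 (erefl : l = ln%:R) (fun=> erefl) rel.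
have [A A0 WQle] := functional_bound Q c0 r0 Wle.
(* [r1 ^+ n] bounds [r ^+ j] for all [j < n] at once, so one threshold [m0] suffices. *)
pose r1 := Num.max 1 r.
have r1_ge1 : 1 <= r1 by rewrite le_max lexx.
have r1_ge0 : 0 <= r1 := le_trans ler01 r1_ge1.
have [m0 small] := exp_lt_fact (mulr_ge0 c0 (exprn_ge0 n r1_ge0)) A0.
pose theta := d * l * h.[g0].
have theta0 : theta != 0 by rewrite !mulf_neq0.
(* Since [N / theta] is integral, [p] dividing [theta ^+ p] will force [p] to divide [N ^ p],
   impossible for a prime [p > N]. *)
have [N N0 intN] := Aint_denom (f theta)^-1.
have [p lt_p pr_p] := prime_above (maxn m0 N).
pose m := p.-1.
have pE : p = m.+1 by rewrite prednK ?prime_gt0.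
have lt_Np : (N < p)%N by apply: leq_ltn_trans lt_p; apply: leq_maxr.
have le_m0 : (m0 <= m)%N by rewrite -ltnS -pE; apply: leq_ltn_trans lt_p; apply: leq_maxl.
have vanish i u : exists v, Q ^+ m * u = ('X - (G i)%:P) ^+ m * v.
  by have [v ->] := rootQ i; exists (v ^+ m * u); rewrite exprMn mulrA.
(* The quotient by [m!] is a conjugation-invariant algebraic integer, hence some [z : int]; the
   growth bound gives [|z| < 1]. *)
have W0 j : (j < n)%N -> W (Q ^+ m * 'X^j) = 0.
  move=> lt_jn.
  have intq : Q ^+ m * 'X^j \is a polyOver (Kint f).
    by rewrite rpredM ?rpredX ?polyOverX.
  have [y inty WE] := hermite_int intl intC intG intq (fun i => vanish i _).
  have {}WE : W (Q ^+ m * 'X^j) = _ := WE.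
  have f_m0 : m`!%:R != 0 :> K := fact0 m.
  have [||z zE] := @Gal_fixed_int (W (Q ^+ m * 'X^j) / m`!%:R).
  - move=> s Gs; have [t bij_t tE] := Gal_perm s Gs.
    rewrite fmorph_div rmorph_nat; congr (_ / _).
    rewrite (hermite_map _ bij_t) ?rmorph_nat //.
    + by rewrite rmorphM rmorphXn /= galQ // map_polyXn.
    + by move=> i; rewrite (tE i).1.
    + by move=> i; rewrite rmorphM rmorph_nat (tE i).2.
  - rewrite WE mulrC mulKf // rpredD ?rpredM ?rpred_nat //.
    apply: rpred_sum => i _; rewrite !rpredM ?rpredX //.
    have /polyOverP-> // : (Q ^+ m * 'X^j) \Po ('X + (G i)%:P) \is a polyOver (Kint f).
    by rewrite polyOver_comp // rpredD ?polyOverX ?polyOverC ?intG.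
  have WzE : W (Q ^+ m * 'X^j) = z%:~R * m`!%:R by rewrite -zE divfK.
  have le1 : normc (k (W (Q ^+ m * 'X^j))) <= c * A ^+ m * r ^+ j := WQle m j.
  rewrite WzE rmorphM rmorph_int rmorph_nat normcM normc_int normc_nat in le1.
  have lt1 : `|z%:~R : R| * m`!%:R < m`!%:R.
    apply: le_lt_trans (small m le_m0); apply: le_trans le1 _.
    rewrite [leRHS]mulrAC ler_wpM2l ?mulr_ge0 ?exprn_ge0 //.
    apply: le_trans (_ : r1 ^+ j <= _).
      by apply: lerXn2r; rewrite ?nnegrE // le_max lexx orbT.
    by apply: ler_weXn2l => //; apply: ltnW.
  have : `|z%:~R : R| < 1.
    by rewrite -(@ltr_pM2r _ m`!%:R) ?mul1r // ltr0n fact_gt0.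
  rewrite -intr_norm -[1]/(1%:~R) ltr_int.
  by rewrite WzE; case: (z) => [[|?]|?] //; rewrite mul0r.
(* [h] has degree below [n], so it is a combination of the monomials just treated. *)
have Wh : W (Q ^+ m * h) = 0.
  have szh : (size h <= n)%N.
    by rewrite size_prod_XsubC size_rem // prednK // /n -has_predT; apply/hasP; exists g0.
  rewrite -[h]coefK poly_def mulr_sumr.
  rewrite [LHS](raddf_sum (hermite C G l : {linear {poly K} -> K | *%R})).
  rewrite big1 // => j _; rewrite -scalerAr.
  rewrite [LHS](linearZ_LR (hermite C G l : {linear {poly K} -> K | *%R})).
  by rewrite [X in _ * X](W0 j) ?mulr0 // (leq_trans _ szh).
have intq : Q ^+ m * h \is a polyOver (Kint f) by rewrite rpredM ?rpredX.
have [y inty WhE] := hermite_int intl intC intG intq (fun i => vanish i _).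
have {WhE} : W (Q ^+ m * h) = m`!%:R * (\sum_i C i * l ^+ m *
  ((Q ^+ m * h) \Po ('X + (G i)%:P))`_m + m.+1%:R * y) := WhE.
rewrite Wh => /esym/eqP; rewrite mulf_eq0 (negPf (fact0 m)) -pE /= => /eqP WE.
(* At a root other than [g0], [h] supplies one more factor and [Q ^+ m * h] vanishes to order
   [p = m.+1], so its shifted coefficient of degree [m] is 0. At [g0] that coefficient is [h.[g0] ^+
   p]. *)
have sumE : \sum_i C i * l ^+ m * ((Q ^+ m * h) \Po ('X + (G i)%:P))`_m =
    d * l ^+ m * h.[g0] ^+ p.
  rewrite /d !mulr_suml [RHS]big_mkcond; apply: eq_bigr => i _.
  case: eqP => [Bi|nBi].
    rewrite /G Bi -/g0 QE exprMn -[_ * h ^+ m * h]mulrA -exprSr coef_shift_root ltnn subnn.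
    by rewrite coef0_shift horner_exp -pE.
  have [v vE] : exists v, Q ^+ m * h = ('X - (G i)%:P) ^+ p * v.
    have Gh : G i \in rem g0 S.
      rewrite mem_rem_uniq // inE S_G andbT; apply/eqP => /(mulfI l0); exact: nBi.
    have [u ->] := rootQ i; rewrite /h (big_rem _ Gh) /= exprMn.
    set w := \prod_(_ <- _) _; exists (u ^+ m * w).
    by rewrite pE exprSr; ring.
  by rewrite vE coef_shift_root pE ltnSn mulr0.
(* The factor [d ^+ m * l] completes [d * l ^+ m * h.[g0] ^+ p] to a full [p]-th power. *)
have thetaE : theta ^+ p = p%:R * (- (d ^+ m * l * y)).
  have -> : theta ^+ p = d ^+ m * l * (d * l ^+ m * h.[g0] ^+ p).
    by rewrite /theta !exprMn pE !exprS; ring.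
  have -> : d * l ^+ m * h.[g0] ^+ p = - (p%:R * y).
    by apply/eqP; rewrite -sumE -addr_eq0 WE.
  by ring.
have intd : d \in Kint f by apply: rpred_sum.
have NpE : N%:R ^+ p = p%:R * ((N%:R * (f theta)^-1) ^+ p * f (- (d ^+ m * l * y))).
  have ft0 : f theta != 0 by rewrite fmorph_eq0.
  rewrite mulrCA -[p%:R](rmorph_nat f) -rmorphM -thetaE rmorphXn -exprMn.
  by rewrite mulfVK.
have : (p %| N ^ p)%N.
  rewrite -eqAmod0_nat; suff : (((N ^ p)%:R : algC) == 0 %[mod p%:R])%A by [].
  rewrite natrX NpE eqAmodMr0 // rpredM ?rpredX //.
  by rewrite -KintE rpredN !rpredM ?rpredX.
rewrite Euclid_dvdX // => /andP[/(dvdn_leq N0)]; by rewrite leqNgt lt_Np.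
Qed.

Lemma common_denom (F : J -> K) :
  exists2 N : nat, (0 < N)%N & forall i, N%:R * F i \in Kint f.
Proof.
have [N N0 NF] := fin_all_exists2 (fun i => Aint_denom (f (F i))).
exists (\prod_i N i)%N => [|i]; first by rewrite prodn_gt0.
rewrite (bigD1 i) //= natrM mulrAC mulrC rpredM ?rpred_nat // KintE.
by rewrite rmorphM rmorph_nat.
Qed.

Lemma hermite_conjugates (C B : J -> K) (b0 : K) :
    (forall s, Gal s -> exists2 t : J -> J, bijective t &
       forall i, s (C i) = C (t i) /\ s (B i) = B (t i)) ->
    \sum_i k (C i) * cexp (k (B i)) = 0 ->
  \sum_(i | B i == b0) C i = 0.
Proof.
move=> Gal_perm rel.
have [N N0 intC] := common_denom C; have [l l0 intB] := common_denom B.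
apply: (mulfI (natr_neq0 N0)); rewrite mulr0 mulr_sumr.
apply: (@hermite_conjugates_int (fun i => N%:R * C i) B l) => // [s Gs|].
  have [t bij_t tE] := Gal_perm s Gs; exists t => // i.
  by rewrite rmorphM rmorph_nat (tE i).1 (tE i).2.
transitivity (k N%:R * \sum_i k (C i) * cexp (k (B i))); last by rewrite rel mulr0.
by rewrite mulr_sumr; apply: eq_bigr => i _; rewrite rmorphM mulrA.
Qed.

End Conjugates.

(** * The Lindemann-Weierstrass theorem *)

(** Let [L] be generated by all roots of the product of the minimal polynomials; that product is
    rational and splits in [L]. *)
Lemma galois_closure (s : seq algC) :
  exists (L : splittingFieldType rat) (f : {rmorphism L -> algC}),
    {in s, forall x, exists y, f y = x}.
Proof.
pose p := \prod_(x <- s) minCpoly x.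
have [r pE] := closed_field_poly_normal p.
have [q Dq mon_q] : exists2 q : {poly rat}, p = map_poly ratr q & q \is monic.
  rewrite /p; elim: s {p r pE} => [|x s [q Dq mon_q]].
    by exists 1; rewrite ?monic1 // big_nil rmorph1.
  have [qx [Dqx mon_qx] _] := minCpolyP x.
  by exists (qx * q); rewrite ?monicMl // big_cons Dq Dqx rmorphM.
have {}pE : p = \prod_(z <- r) ('X - z%:P).
  rewrite pE; have /monicP -> : p \is monic by rewrite Dq map_monic.
  by rewrite scale1r.
have [L [f [r1 fr1 gen]]] := num_field_exists r.
have axL : splitting_field_axiom L.
  exists (\prod_(z <- r1) ('X - z%:P)); last by exists r1; rewrite ?eqpxx.
  have -> : \prod_(z <- r1) ('X - z%:P) = map_poly (in_alg L) q.
    apply: (@map_poly_inj _ _ f).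
    rewrite -map_poly_comp rmorph_prod.
    under eq_bigr do rewrite rmorphB /= map_polyX map_polyC /=.
    rewrite -(big_map f xpredT (fun z => 'X - z%:P)) fr1 -pE Dq.
    by apply: eq_map_poly => a /=; rewrite alg_num_field fmorph_rat.
  by apply/polyOverP => i; rewrite coef_map /= rpredZ ?mem1v.
pose L' : splittingFieldType rat :=
  HB.pack L (FieldExt_isSplittingField.Build rat L axL).
exists L', f => x s_x.
have : root p x.
  by rewrite /p (big_rem _ s_x) rootM root_minCpoly.
rewrite pE root_prod_XsubC -fr1 => /mapP[y _ ->]; by exists y.
Qed.

(** In characteristic 0 the splitting field is separable, hence Galois over the rationals, and its
    fixed field is the base field. *)
Lemma gal_fixed_rat (L : splittingFieldType rat) (f : {rmorphism L -> algC}) x :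
  (forall s : gal_of {:L}, s x = x) -> f x \in Crat.
Proof.
move=> fix_x.
have gal1 : galois 1 {:L}.
  rewrite /galois sub1v normalFieldf andbT /=.
  apply/separableP => y _; apply/negPn/negP => /separablePn_pchar[p + _].
  by rewrite pchar_lalg pchar_num.
have : x \in fixedField 'Gal({:L} / 1)%g by apply/fixedFieldP; rewrite ?memvf.
rewrite (elimT galois_fixedField gal1) => /vlineP[a ->].
by rewrite alg_num_field fmorph_rat Crat_rat.
Qed.

Lemma cexpD (z w : CC) : cexp (z + w) = cexp z * cexp w.
Proof.
have ReE (p q c s c' s' : R) :
  p * q * (c * c' - s * s') = p * c * (q * c') - p * s * (q * s') by ring.
have ImE (p q c s c' s' : R) :
  p * q * (s * c' + c * s') = p * c * (q * s') + p * s * (q * c') by ring.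
case: z w => [a b] [c d]; rewrite /cexp /= -expRD cosD sinD.
apply/eqP; rewrite eq_complex /= !mul0r !subr0 !addr0.
by apply/andP; split; apply/eqP; [exact: ReE | exact: ImE].
Qed.

Lemma cexp0 : cexp 0 = 1.
Proof.
have -> : cexp 0 = (1 : R)%:C * ((1 : R) +i* (0 : R)).
  by rewrite /cexp /= exp_0 cos_0 sin_0.
by rewrite rmorph1 mul1r.
Qed.

Lemma cexp_sum (I : finType) (F : I -> CC) : cexp (\sum_i F i) = \prod_i cexp (F i).
Proof. by elim/big_rec2: _ => [|i x y _ <-]; rewrite ?cexp0 ?cexpD. Qed.

(* Any total order compatible with addition would do. *)
Definition lexC (z : CC) : R *l R := (Re z, Im z).

(** Nonnegative differences with zero sum all vanish: first for the real parts, after which the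
    order compares the imaginary parts. *)
Lemma lexC_sum_eq (I : finType) (F G : I -> CC) :
    (forall i, lexC (F i) <= lexC (G i))%O -> \sum_i F i = \sum_i G i -> F =1 G.
Proof.
move=> leFG eqFG.
have le_i i : (Re (F i) <= Re (G i)) && ((Re (G i) <= Re (F i)) ==> (Im (F i) <= Im (G i))).
  by have := leFG i; rewrite /lexC lexi_pair.
have ReE i : Re (F i) = Re (G i).
  apply/eqP; rewrite eq_sym -subr_eq0; apply/eqP; move: i (isT).
  apply: (psumr_eq0P (F := fun i => Re (G i) - Re (F i))) => [i _|].
    by rewrite subr_ge0; case/andP: (le_i i).
  by rewrite sumrB -!(raddf_sum (@complex.Re R : {additive CC -> R})) eqFG subrr.
have ImE i : Im (F i) = Im (G i).
  apply/eqP; rewrite eq_sym -subr_eq0; apply/eqP; move: i (isT).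
  apply: (psumr_eq0P (F := fun i => Im (G i) - Im (F i))) => [i _|].
    by rewrite subr_ge0; case/andP: (le_i i) => _; rewrite ReE lexx.
  by rewrite sumrB -!(raddf_sum (@complex.Im R : {additive CC -> R})) eqFG subrr.
by move=> i; apply/eqP; rewrite eq_complex ReE ImE !eqxx.
Qed.

Theorem lindemann_weierstrass (iota : {rmorphism algC -> CC}) n (c a : 'I_n -> algC) :
  injective a -> \sum_i iota (c i) * cexp (iota (a i)) = 0 -> forall i, c i = 0.
Proof.
move=> inj_a rel i1; apply/eqP/negPn/negP => c_i1.
have [L [f fP]] :=
  galois_closure ([seq c i | i <- enum 'I_n] ++ [seq a i | i <- enum 'I_n]).
have fc i : exists y, f y = c i by apply: fP; rewrite mem_cat map_f ?mem_enum.
have fa i : exists y, f y = a i by apply: fP; rewrite mem_cat orbC map_f ?mem_enum.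
have [c' c'E] := fin_all_exists fc; have [a' a'E] := fin_all_exists fa.
pose gT := gal_of {:L}.
pose J := {ffun gT -> 'I_n}.
pose C (phi : J) : L := \prod_(s : gT) s (c' (phi s)).
pose B (phi : J) : L := \sum_(s : gT) s (a' (phi s)).
pose k : {rmorphism L -> CC} := iota \o f.
have inj_k : injective k by apply: fmorph_inj.
(* Expanding the product of the formal conjugates gives this sum. The conjugates need not vanish,
   but the factor at the identity is the given relation. *)
have relJ : \sum_phi k (C phi) * cexp (k (B phi)) = 0.
  transitivity (\prod_(s : gT) \sum_i k (s (c' i)) * cexp (k (s (a' i)))).
    rewrite bigA_distr_bigA; apply: eq_bigr => phi _.
    by rewrite /C /B rmorph_prod rmorph_sum cexp_sum -big_split.
  rewrite (bigD1 1%g) //= [X in X * _](_ : _ = 0) ?mul0r // -[RHS]rel.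
  by apply: eq_bigr => i _; rewrite !gal_id c'E a'E.
pose Gal (s : {rmorphism L -> L}) := exists g : gT, s =1 g.
have fixedG x : (forall s, Gal s -> s x = x) -> f x \in Crat.
  by move=> fix_x; apply: gal_fixed_rat => g; apply: (fix_x g); exists g.
pose key (s : gT) i := lexC (k (s (a' i))).
(* For each [s], an index whose conjugate exponent is largest among those with nonzero
   coefficient. *)
pose top (s : gT) := [arg max_(i > i1 | c i != 0) key s i]%O.
have topP s : c (top s) != 0 /\ forall i, c i != 0 -> (key s i <= key s (top s))%O.
  by rewrite /top; case: arg_maxP => // i ci le_i.
pose phi0 : J := [ffun s => top s].
have gal0 (s : gT) x : (s x == 0) = (x == 0) by rewrite fmorph_eq0.
have gal_inj (s : gT) : injective s by apply: fmorph_inj.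
have c'0 i : (c' i == 0) = (c i == 0) by rewrite -c'E fmorph_eq0.
have Cphi0 : C phi0 != 0.
  apply/prodf_neq0 => s _; rewrite gal0 c'0 ffunE; exact: (topP s).1.
(* A [phi] with [C phi != 0] is termwise at most [phi0], so equal sums force [phi = phi0]. Hence
   [C phi0] is the whole coefficient of the exponent [B phi0]. *)
have C_eq0 phi : B phi = B phi0 -> phi != phi0 -> C phi = 0.
  move=> eqB; apply: contraNeq => /prodf_neq0 Cphi.
  have nz s : c (phi s) != 0 by rewrite -c'0 -(gal0 s) Cphi.
  have eqk := @lexC_sum_eq gT (fun s : gT => k (s (a' (phi s))))
    (fun s : gT => k (s (a' (phi0 s)))).
  apply/eqP/ffunP => s; apply: inj_a; rewrite -!a'E; congr (f _).
  apply: (gal_inj s); apply: inj_k; apply: eqk => [t|].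
    by rewrite ffunE; apply: (topP t).2.
  by rewrite -!rmorph_sum; congr (k _).
have Gal_perm s : Gal s -> exists2 t : J -> J, bijective t &
    forall phi, s (C phi) = C (t phi) /\ s (B phi) = B (t phi).
  (* Applying [g] to the [u]-th factor gives the factor at [u * g], so [g] acts on [J] by right
     translation of the argument. *)
  case=> g sE; pose t (h : gT) (phi : J) : J := [ffun s => phi (s * h^-1)%g].
  exists (t g).
    by exists (t g^-1)%g => phi; apply/ffunP => u; rewrite !ffunE ?invgK ?mulgK ?mulgKV.
  have gM (u : gT) x : g (u x) = (u * g)%g x by rewrite galM ?memvf.
  move=> phi; rewrite rmorph_prod rmorph_sum; split.
    rewrite [RHS](reindex_inj (mulIg g)); apply: eq_bigr => u _.
    by rewrite sE gM ffunE mulgK.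
  rewrite [RHS](reindex_inj (mulIg g)); apply: eq_bigr => u _.
  by rewrite sE gM ffunE mulgK.
have := hermite_conjugates fixedG (B phi0) Gal_perm relJ.
rewrite (bigD1 phi0) //= big1 => [|phi /andP[/eqP]]; last exact: C_eq0.
by rewrite addr0 => /eqP; apply/negP.
Qed.

(** * The ideal of trigonometric relations *)

Section TrigAlgebra.
Variables (F : numFieldType) (i : F).
Hypothesis ii : i * i = -1.

Lemma trig_i_neq0 : i != 0.
Proof. by apply: contra_eq_neq ii => ->; rewrite mul0r eq_sym oppr_eq0 oner_eq0. Qed.

(** Trades [1 / i] for [- i], so that afterwards [i] occurs only polynomially and [i * i] can be
    rewritten. *)
Lemma trig_divi (x : F) : x / (2%:R * i) = - (x * i) / 2%:R.
Proof.
have i0 := trig_i_neq0; have two0 : (2%:R : F) != 0 by rewrite pnatr_eq0.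
have -> : - (x * i) = - (i * i) * (x / i) by field.
by rewrite ii; field; rewrite i0.
Qed.

Lemma trig_sqr (e e' : F) : e * e' = 1 ->
  ((e + e') / 2%:R) ^+ 2 + ((e - e') / (2%:R * i)) ^+ 2 = 1.
Proof.
rewrite trig_divi => ee.
have -> : ((e + e') / 2%:R) ^+ 2 + (- ((e - e') * i) / 2%:R) ^+ 2 =
  ((e + e') ^+ 2 + (e - e') ^+ 2 * (i * i)) / 4%:R by field.
rewrite ii; have -> : (e + e') ^+ 2 + (e - e') ^+ 2 * -1 = 4%:R * (e * e') by ring.
by rewrite ee mulr1 divff // pnatr_eq0.
Qed.

Lemma trig_cosD (x x' y y' : F) :
  (x * y + x' * y') / 2%:R = (x + x') / 2%:R * ((y + y') / 2%:R) -
    (x - x') / (2%:R * i) * ((y - y') / (2%:R * i)).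
Proof.
rewrite !trig_divi.
have -> : (- ((x - x') * i)) / 2%:R * (- ((y - y') * i) / 2%:R) =
  (x - x') * (y - y') * (i * i) / 4%:R by field.
by rewrite ii; field.
Qed.

Lemma trig_sinD (x x' y y' : F) :
  (x * y - x' * y') / (2%:R * i) = (x - x') / (2%:R * i) * ((y + y') / 2%:R) +
    (x + x') / 2%:R * ((y - y') / (2%:R * i)).
Proof. by rewrite !trig_divi; field. Qed.

End TrigAlgebra.

Lemma cexpNr z : cexp z * cexp (- z) = 1.
Proof. by rewrite -cexpD subrr cexp0. Qed.

Lemma mulii : ('i : CC) * 'i = -1.
Proof. by rewrite -expr2 sqr_i. Qed.

Lemma ccos_csin_sqr z : ccos z ^+ 2 + csin z ^+ 2 = 1.
Proof. exact: trig_sqr mulii _ _ (cexpNr _). Qed.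

Lemma ccosD z w : ccos (z + w) = ccos z * ccos w - csin z * csin w.
Proof. by rewrite /ccos /csin mulrDr opprD !cexpD; apply: (trig_cosD mulii). Qed.

Lemma csinD z w : csin (z + w) = csin z * ccos w + ccos z * csin w.
Proof. by rewrite /ccos /csin mulrDr opprD !cexpD; apply: (trig_sinD mulii). Qed.

(** * Evaluation is multiplicative and kills the ideal *)

Section Evaluation.
Variable iota : {rmorphism algC -> CC}.

(** Variables outside the support contribute exponent 0; this allows two monomials to be multiplied
    over a common support. *)
Lemma ev_monomEw (d : {fset var}) (m : {cmonom var}) : (finsupp m `<=` d)%fset ->
  ev_monom iota m = \prod_(v <- d) ev_var iota v ^+ m v.
Proof.
move=> le; rewrite /ev_monom (big_fset_incl _ le) // => v _.
by rewrite -cmE_neq0 negbK => /eqP ->.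
Qed.

Lemma ev_monom_mmorphism : mmorphism (ev_monom iota).
Proof.
split=> [m1 m2|]; last by rewrite /ev_monom mdom1 big_seq_fset0.
rewrite [LHS]/ev_monom mdomD (ev_monomEw (fsubsetUl _ (finsupp m2))).
rewrite (ev_monomEw (fsubsetUr (finsupp m1) _)) -big_split /=.
by apply: eq_bigr => v _; rewrite cmM exprD.
Qed.

HB.instance Definition _ :=
  monalg.isMultiplicative.Build {cmonom var} CC (ev_monom iota) ev_monom_mmorphism.

Lemma evD P Q : ev iota (P + Q) = ev iota P + ev iota Q.
Proof. exact: mmapD. Qed.

Lemma evB P Q : ev iota (P - Q) = ev iota P - ev iota Q.
Proof. exact: mmapB. Qed.

Lemma evM P Q : ev iota (P * Q) = ev iota P * ev iota Q.
Proof. exact: (@mmap_is_multiplicative _ _ _ iota (ev_monom iota)).1. Qed.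

Lemma ev_sqr P : ev iota (P ^+ 2) = ev iota P ^+ 2.
Proof. exact: (rmorphXn (mmap iota (ev_monom iota))). Qed.

Lemma ev_sum (I : Type) (r : seq I) (F : I -> A) :
  ev iota (\sum_(i <- r) F i) = \sum_(i <- r) ev iota (F i).
Proof. exact: (raddf_sum (mmap iota (ev_monom iota))). Qed.

Lemma evC c : ev iota c%:MP = iota c.
Proof. exact: mmapC. Qed.

Lemma evU v : ev iota << ucm v >> = ev_var iota v.
Proof.
by rewrite /ev mmapU [X in X * _](rmorph1 iota) mul1r /ev_monom mdomU big_seq_fset1 cmUU.
Qed.

Lemma evX a : ev iota (Xv a) = ccos (iota a).
Proof. exact: evU. Qed.

Lemma evY a : ev iota (Yv a) = csin (iota a).
Proof. exact: evU. Qed.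

(* In the next three lemmas the values are variables because matching a pattern
   such as [ev iota (_ * _)] against [ev iota (Xv a)] makes conversion unfold the
   monoid algebra and diverge. *)
Lemma ev_sqr_sum P Q x y : ev iota P = x -> ev iota Q = y ->
  x ^+ 2 + y ^+ 2 = 1 -> ev iota (P ^+ 2 + Q ^+ 2 - 1) = 0.
Proof.
move=> <- <- xy1; rewrite evB evD -[RHS](subrr 1) -[in RHS]xy1.
by congr (_ + _ - _); [exact: ev_sqr | exact: ev_sqr | rewrite xy1; exact: mmap1].
Qed.

Lemma ev_cosD P P1 P2 Q1 Q2 z x1 x2 y1 y2 :
    ev iota P = z -> ev iota P1 = x1 -> ev iota P2 = x2 ->
    ev iota Q1 = y1 -> ev iota Q2 = y2 -> z = x1 * x2 - y1 * y2 ->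
  ev iota (P - P1 * P2 + Q1 * Q2) = 0.
Proof.
move=> <- <- <- <- <- zE.
transitivity (ev iota P - ev iota P1 * ev iota P2 + ev iota Q1 * ev iota Q2).
  by rewrite evD evB; congr (_ - _ + _); exact: evM.
by rewrite zE; ring.
Qed.

Lemma ev_sinD P P1 P2 Q1 Q2 z x1 x2 y1 y2 :
    ev iota P = z -> ev iota P1 = x1 -> ev iota P2 = x2 ->
    ev iota Q1 = y1 -> ev iota Q2 = y2 -> z = y1 * x2 + x1 * y2 ->
  ev iota (P - Q1 * P2 - P1 * Q2) = 0.
Proof.
move=> <- <- <- <- <- zE.
transitivity (ev iota P - ev iota Q1 * ev iota P2 - ev iota P1 * ev iota Q2).
  by rewrite evB evB; congr (_ - _ - _); exact: evM.
by rewrite zE -addrA -opprD subrr.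
Qed.

Lemma ev_generator g : is_generator g -> ev iota g = 0.
Proof.
move=> [a [b gE]].
have D := rmorphD iota a b.
have XD : ev iota (Xv (a + b)) = _ := etrans (evX _) (etrans (congr1 ccos D) (ccosD _ _)).
have YD : ev iota (Yv (a + b)) = _ := etrans (evY _) (etrans (congr1 csin D) (csinD _ _)).
case: gE => [->|[->|->]].
- exact: ev_sqr_sum (evX a) (evY a) (ccos_csin_sqr _).
- exact: ev_cosD XD (evX a) (evX b) (evY a) (evY b) (erefl _).
- exact: ev_sinD YD (evX a) (evX b) (evY a) (evY b) (erefl _).
Qed.

Lemma ev_ideal P : in_ideal P -> ev iota P = 0.
Proof.
move=> [s [gen ->]]; rewrite ev_sum big_seq big1 // => c /gen gc.
by rewrite evM (ev_generator gc) mulr0.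
Qed.

End Evaluation.

(** * Reduction to combinations of formal exponentials *)

Section TrigIdeal.
Variables (S : comNzRingType) (sc : {rmorphism algC -> S}) (I : S -> Prop).
Hypotheses (I0 : I 0) (ID : forall P Q, I P -> I Q -> I (P + Q)).
Hypothesis IM : forall P Q, I Q -> I (P * Q).
Variables X Y : algC -> S.
Hypothesis I_sqr : forall a, I (X a ^+ 2 + Y a ^+ 2 - 1).
Hypothesis I_cosD : forall a b, I (X (a + b) - X a * X b + Y a * Y b).
Hypothesis I_sinD : forall a b, I (Y (a + b) - Y a * X b - X a * Y b).
Variable i : algC.
Hypothesis ii : i * i = -1.

Let j := sc i.
Definition formal_exp a : S := X a + j * Y a.
Let E := formal_exp.
Let F a : S := X a - j * Y a.

Let jj : j * j = -1. Proof. by rewrite -rmorphM ii rmorphN1. Qed.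

Let IN P : I P -> I (- P). Proof. by rewrite -mulN1r; apply: IM. Qed.

Let IB P Q : I P -> I Q -> I (P - Q). Proof. by move=> IP IQ; apply: ID (IN IQ). Qed.

Lemma formal_expD a b : I (E (a + b) - E a * E b).
Proof.
(* The cosine generator plus [j] times the sine generator, with the multiple of [j * j + 1], which
   is 0, split off. *)
have -> : E (a + b) - E a * E b = X (a + b) - X a * X b + Y a * Y b +
    j * (Y (a + b) - Y a * X b - X a * Y b) - (j * j + 1) * (Y a * Y b).
  by rewrite /E /formal_exp; ring.
by rewrite jj addNr mul0r subr0; apply: ID (I_cosD a b) (IM _ (I_sinD a b)).
Qed.

Lemma formal_exp_conj a : I (E a * F a - 1).
Proof.
have -> : E a * F a - 1 = X a ^+ 2 + Y a ^+ 2 - 1 - (j * j + 1) * Y a ^+ 2.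
  by rewrite /E /F /formal_exp; ring.
by rewrite jj addNr mul0r subr0; apply: I_sqr.
Qed.

(** Modulo [I], [E 0] is idempotent by additivity and invertible with inverse [F 0], hence 1. *)
Lemma formal_exp0 : I (E 0 - 1).
Proof.
have -> : E 0 - 1 = F 0 * (- (E 0 - E 0 * E 0)) - (E 0 - 1) * (E 0 * F 0 - 1) by ring.
apply: IB; apply: IM; last exact: formal_exp_conj.
by apply: IN; have := formal_expD 0 0; rewrite addr0.
Qed.

(** Both [F a] and [E (- a)] are inverses of [E a] modulo [I]. *)
Lemma formal_expN a : I (F a - E (- a)).
Proof.
have EN : I (E a * E (- a) - 1).
  have -> : E a * E (- a) - 1 = E 0 - 1 - (E 0 - E a * E (- a)) by ring.
  by apply: IB formal_exp0 _; have := formal_expD a (- a); rewrite subrr.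
have -> : F a - E (- a) = E (- a) * (E a * F a - 1) - F a * (E a * E (- a) - 1) by ring.
by apply: IB; apply: IM => //; apply: formal_exp_conj.
Qed.

Definition exp_comb (s : seq (algC * algC)) : S := \sum_(x <- s) sc x.1 * E x.2.

Definition exp_span P := exists s, I (P - exp_comb s).

Lemma exp_span_eq P Q : I (P - Q) -> exp_span Q -> exp_span P.
Proof.
by move=> PQ [s Qs]; exists s; have := ID PQ Qs; rewrite addrA subrK.
Qed.

Lemma exp_spanD P Q : exp_span P -> exp_span Q -> exp_span (P + Q).
Proof.
move=> [s Ps] [t Qt]; exists (s ++ t); have := ID Ps Qt.
by rewrite /exp_comb big_cat opprD addrACA.
Qed.

Lemma exp_span_sum (T : Type) (r : seq T) (G : T -> S) :
  (forall x, exp_span (G x)) -> exp_span (\sum_(x <- r) G x).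
Proof.
move=> spanG; elim/big_ind: _ => [|P Q|x _]; [|exact: exp_spanD|exact: spanG].
by exists [::]; rewrite /exp_comb big_nil subr0.
Qed.

Lemma exp_spanE c a : exp_span (sc c * E a).
Proof. by exists [:: (c, a)]; rewrite /exp_comb big_seq1 subrr. Qed.

Lemma exp_span1 : exp_span 1.
Proof.
apply: exp_span_eq (exp_spanE 1 0).
by rewrite rmorph1 mul1r -opprB; apply: IN formal_exp0.
Qed.

Lemma exp_spanM P Q : exp_span P -> exp_span Q -> exp_span (P * Q).
Proof.
move=> [s Ps] [t Qt]; apply: (@exp_span_eq _ (exp_comb s * exp_comb t)).
  have -> : P * Q - exp_comb s * exp_comb t =
    Q * (P - exp_comb s) + exp_comb s * (Q - exp_comb t) by ring.
  by apply: ID; apply: IM.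
rewrite /exp_comb mulr_suml; apply: exp_span_sum => x.
rewrite mulr_sumr; apply: exp_span_sum => y.
apply: exp_span_eq (exp_spanE (x.1 * y.1) (x.2 + y.2)).
rewrite rmorphM; have -> : sc x.1 * E x.2 * (sc y.1 * E y.2) -
  sc x.1 * sc y.1 * E (x.2 + y.2) =
  (- (sc x.1 * sc y.1)) * (E (x.2 + y.2) - E x.2 * E y.2) by ring.
exact: IM (formal_expD _ _).
Qed.

Lemma exp_spanC c : exp_span (sc c).
Proof.
have := exp_spanM (exp_spanE c 0) exp_span1; apply: exp_span_eq.
rewrite mulr1 -{1}[sc c]mulr1 -mulrBr -opprB; exact/IM/IN/formal_exp0.
Qed.

Let half : S := sc 2%:R^-1.
Let half2 : half * 2%:R = 1.
Proof. by rewrite /half -(rmorph_nat sc) -rmorphM mulVf ?rmorph1 // pnatr_eq0. Qed.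

Lemma exp_span_cos a : exp_span (X a).
Proof.
apply: exp_span_eq (exp_spanD (exp_spanE 2%:R^-1 a) (exp_spanE 2%:R^-1 (- a))).
rewrite -/half; have -> : X a - (half * E a + half * E (- a)) =
   half * (F a - E (- a)) + (1 - half * 2%:R) * X a.
  by rewrite /E /F /formal_exp; ring.
by rewrite half2 subrr mul0r addr0; apply: IM (formal_expN a).
Qed.

Lemma exp_span_sin a : exp_span (Y a).
Proof.
(* The coefficients are [1 / (2 i)] and [- 1 / (2 i)]. *)
apply: exp_span_eq (exp_spanD (exp_spanE (- i / 2%:R) a) (exp_spanE (i / 2%:R) (- a))).
rewrite !rmorphM rmorphN -/half -/j.
have -> : Y a - (- j * half * E a + j * half * E (- a)) =
   j * half * (F a - E (- a)) + (1 + (j * j) * (half * 2%:R)) * Y a.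
  by rewrite /E /F /formal_exp; ring.
by rewrite half2 jj mulr1 subrr mul0r addr0; apply: IM (formal_expN a).
Qed.

End TrigIdeal.

(** * Every polynomial is congruent to such a combination *)

Lemma in_ideal0 : in_ideal 0.
Proof. by exists [::]; split; rewrite ?big_nil. Qed.

Lemma in_idealD P Q : in_ideal P -> in_ideal Q -> in_ideal (P + Q).
Proof.
move=> [s [gs ->]] [t [gt ->]]; exists (s ++ t); split; last by rewrite big_cat.
by move=> c; rewrite mem_cat => /orP[/gs|/gt].
Qed.

Lemma in_idealM P Q : in_ideal Q -> in_ideal (P * Q).
Proof.
move=> [s [gs ->]]; exists [seq (P * c.1, c.2) | c <- s]; split.
  by move=> _ /mapP[c /gs gc ->].
by rewrite big_map mulr_sumr; apply: eq_bigr => c _; rewrite mulrA.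
Qed.

Lemma in_ideal_gen g : is_generator g -> in_ideal g.
Proof.
move=> gg; exists [:: (1, g)]; split; last by rewrite big_seq1 mul1r.
by move=> c; rewrite inE => /eqP ->.
Qed.

Definition cstA : {rmorphism algC -> A} := @malgC {cmonom var} algC.
Local Notation iC := (Num.imaginary : algC).

Lemma mulCii : iC * iC = -1.
Proof. by rewrite -expr2 sqrCi. Qed.

Lemma in_ideal_sqr a : in_ideal (Xv a ^+ 2 + Yv a ^+ 2 - 1).
Proof. by apply: in_ideal_gen; exists a, a; left. Qed.

Lemma in_ideal_cosD a b : in_ideal (Xv (a + b) - Xv a * Xv b + Yv a * Yv b).
Proof. by apply: in_ideal_gen; exists a, b; right; left. Qed.

Lemma in_ideal_sinD a b : in_ideal (Yv (a + b) - Yv a * Xv b - Xv a * Yv b).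
Proof. by apply: in_ideal_gen; exists a, b; right; right. Qed.

Local Notation spanned := (exp_span cstA in_ideal Xv Yv iC).

Lemma malgUM (c1 c2 : algC) (m1 m2 : {cmonom var}) :
  << c1 *g m1 >> * << c2 *g m2 >> = << c1 * c2 *g mmul m1 m2 >> :> A.
Proof. by rewrite malgM_def fgmulUU. Qed.

Lemma spannedM P Q : spanned P -> spanned Q -> spanned (P * Q).
Proof.
exact: (exp_spanM in_ideal0 in_idealD in_idealM in_ideal_cosD in_ideal_sinD mulCii).
Qed.

Lemma spanned_var v : spanned << ucm v >>.
Proof.
case: v => a []; [rewrite -/(Xv a) | rewrite -/(Yv a)].
  exact: (@exp_span_cos _ cstA in_ideal in_ideal0 in_idealD in_idealM Xv Yv
            in_ideal_sqr in_ideal_cosD in_ideal_sinD iC mulCii a).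
exact: (@exp_span_sin _ cstA in_ideal in_ideal0 in_idealD in_idealM Xv Yv
          in_ideal_sqr in_ideal_cosD in_ideal_sinD iC mulCii a).
Qed.

Lemma spannedC c : spanned c%:MP.
Proof.
exact: (@exp_spanC _ cstA in_ideal in_ideal0 in_idealD in_idealM Xv Yv
          in_ideal_sqr in_ideal_cosD in_ideal_sinD iC mulCii c).
Qed.

Lemma spanned_monom (m : {cmonom var}) : spanned << m >>.
Proof.
have [n] := ubnP (mdeg m); elim: n m => // n IH m.
have [-> _|m1 lt_mn] := eqVneq m mone; first exact: spannedC.
have [v v_m] : exists v, m v != 0%N.
  have [E|[v v_m]] := fset_0Vmem (finsupp m); last by exists v; rewrite cmE_neq0.
  by case/eqP: m1; apply: mdeg_eq0I; rewrite mdegE E big_seq_fset0.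
have mE : m = mmul (ucm v) (divcm m (ucm v)).
  apply/eqP/cmP => u; rewrite cmM divcmE cmU subnKC //.
  by case: eqP => // <-; rewrite lt0n.
rewrite mE; have -> : << mmul (ucm v) (divcm m (ucm v)) >> =
    << ucm v >> * << divcm m (ucm v) >> :> A by rewrite malgUM mulr1.
apply: spannedM (spanned_var v) (IH _ _).
by move: lt_mn; rewrite {1}mE mdegM mdegU add1n.
Qed.

Lemma spannedT P : spanned P.
Proof.
rewrite [P]monalgE; apply: (exp_span_sum in_ideal0 in_idealD) => m.
have mE : mmul mone m = m by apply/eqP/cmP => v; rewrite cmM cm1.
have -> : << P@_m *g m >> = (P@_m)%:MP * << m >> :> A.
  apply/esym; apply: etrans (malgUM _ _ _ _) _.
  by rewrite mE; congr (mkmalgU _ _); apply: mulr1.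
exact: spannedM (spannedC _) (spanned_monom _).
Qed.

(** The embedding may send [iC] to ['i] or to [- 'i]; Euler's formula gives the result in either
    case. *)
Lemma ev_formal_exp (iota : {rmorphism algC -> CC}) a :
  ev iota (formal_exp cstA Xv Yv iC a) = cexp (iota (iC * a)).
Proof.
transitivity (ccos (iota a) + iota iC * csin (iota a)).
  apply: etrans (evD _ _ _) _; congr (_ + _); first exact: evX.
  by apply: etrans (evM _ _ _) _; congr (_ * _); [exact: evC | exact: evY].
have i0 : ('i : CC) != 0 := trig_i_neq0 mulii.
rewrite rmorphM; set w := iota iC; set z := iota a.
have : (w - 'i) * (w + 'i) == 0.
  by rewrite -subr_sqr sqr_i -rmorphXn /= sqrCi rmorphN1 subrr.
rewrite mulf_eq0 subr_eq0 addr_eq0 => /orP[]/eqP ->; rewrite /ccos /csin ?mulNr.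
all: by move: (cexp _) (cexp _) => e e'; field; exact: i0.
Qed.

(** Collects terms with the same exponent, since linear independence concerns distinct exponents. *)
Lemma sum_fibers (T : nzRingType) (s : seq (algC * algC)) (g : algC -> T) (h : algC -> T) :
  \sum_(x <- s) g x.1 * h x.2 =
  \sum_(b <- undup (map snd s)) (\sum_(x <- s | x.2 == b) g x.1) * h b.
Proof.
under [RHS]eq_bigr do rewrite mulr_suml.
rewrite (exchange_big_dep xpredT) //= big_seq [RHS]big_seq; apply: eq_bigr => x s_x.
rewrite -big_filter (eq_big_seq (fun=> g x.1 * h x.2)) => [|b]; last first.
  by rewrite mem_filter => /andP[/eqP-> _].
have -> : [seq b <- undup (map snd s) | x.2 == b] = [:: x.2].
  have := filter_pred1_uniq (undup_uniq (map snd s)).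
  move=> /(_ x.2); rewrite mem_undup map_f // => /(_ isT) <-.
  by apply: eq_filter => b; rewrite eq_sym.
by rewrite big_seq1.
Qed.

(* For any (fixed) field embedding iota of Qbar = algC into CC:
   ker(ev) = I. *)
Theorem theorem1 (iota : {rmorphism algC -> CC}) (P : A) :
  ev iota P = 0 <-> in_ideal P.
Proof.
split; last exact: ev_ideal.
move=> evP; have [s Ps] := spannedT P.
(* [P] is congruent to the combination, so it suffices that the latter is zero in [A] itself. *)
suff comb0 : exp_comb cstA Xv Yv iC s = 0 by move: Ps; rewrite comb0 subr0.
have ev_comb : \sum_(x <- s) iota x.1 * cexp (iota (iC * x.2)) = 0.
  transitivity (ev iota (exp_comb cstA Xv Yv iC s)); last first.
    by have := ev_ideal iota Ps; rewrite evB evP sub0r => /eqP; rewrite oppr_eq0 => /eqP.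
  apply/esym; apply: etrans (ev_sum _ _ _) _; apply: eq_bigr => x _.
  by apply: etrans (evM _ _ _) _; congr (_ * _); [exact: evC | exact: ev_formal_exp].
pose r := undup (map snd s); pose coef b := \sum_(x <- s | x.2 == b) x.1.
have coef0 (j : 'I_(size r)) : coef r`_j = 0.
  (* The exponents [iC * r_j] are distinct because [r] has no repetitions and [iC] is not 0. *)
  apply: (@lindemann_weierstrass iota _ (fun j : 'I__ => coef r`_j) (fun j => iC * r`_j)).
    move=> j1 j2 /(mulfI (trig_i_neq0 mulCii))/eqP.
    by rewrite nth_uniq ?undup_uniq // => /eqP/val_inj.
  rewrite -[RHS]ev_comb (sum_fibers s iota (fun b => cexp (iota (iC * b)))).
  rewrite (big_nth 0) big_mkord; apply: eq_bigr => i _.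
  by rewrite rmorph_sum.
rewrite /exp_comb (sum_fibers s cstA) (big_nth 0) big_mkord big1 // => j _.
have -> : \sum_(x <- s | x.2 == r`_j) cstA x.1 = cstA (coef r`_j) by rewrite rmorph_sum.
by rewrite coef0 rmorph0 mul0r.
Qed.
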